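(* Let $p\in\mathbb{R}[\boldsymbol{x}]$, let $\mathcal{I}\subset\mathbb{R}[\boldsymbol{x}]$ be an ideal, and let $\boldsymbol{h}=(h_1,\dots,h_m)\in\mathbb{R}[\boldsymbol{x}]^m$ be a tuple of $\mathcal{I}$-spherical polynomials such that $p+\mathcal{I}\in U_{2k,\mathcal{I}}(\boldsymbol{h})$ for some $k\in\mathbb{N}$. Let $\kappa\in\mathbb{N}$ be the smallest such $k$. Let $\boldsymbol{M}_k(1)$ and $\boldsymbol{M}_k(p)$, $k\ge\kappa$, be the matrices generated by the Iterative Construction, initialized by Method 1 or by Method 2 with $\boldsymbol{M}_\kappa(1)\succ 0$. Then for every $k\ge\kappa$ the problem $$\lambda_{\min}(\boldsymbol{M}_k(p),\boldsymbol{M}_k(1))=\max_{\gamma\in\mathbb{R}}\ \gamma\quad\text{s.t.}\quad \boldsymbol{M}_k(p)-\gamma\,\boldsymbol{M}_k(1)\succeq 0$$ is a spectral relaxation of the problem of minimizing $p$ over $V_{\mathbb{R}}(\mathcal{I})$. In particular, $\{\lambda_{\min}(\boldsymbol{M}_k(p),\boldsymbol{M}_k(1))\}_{k\ge\kappa}$ is a non-decreasing sequence of lower bounds for the minimum value of $p$ over $V_{\mathbb{R}}(\mathcal{I})$.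
   Context: $\mathbb{R}[\boldsymbol{x}]$ is the polynomial ring in $\boldsymbol{x}=(x_1,\dots,x_n)$; $\mathbb{N}$ is the set of nonnegative integers. For an ideal $\mathcal{I}$, $f\equiv_{\mathcal{I}}g$ means $f-g\in\mathcal{I}$ (entrywise for tuples), and $V_{\mathbb{R}}(\mathcal{I})=\{\boldsymbol{x}\in\mathbb{R}^n: g(\boldsymbol{x})=0\ \forall g\in\mathcal{I}\}$. For a tuple $\boldsymbol{z}$ of polynomials, $\boldsymbol{z}+\mathcal{I}$ is the tuple of classes mod $\mathcal{I}$. $\mathbb{S}^d$ is the space of real symmetric $d\times d$ matrices. Polynomials $h_1,\dots,h_m$ are $\mathcal{I}$-spherical if $\sum_{i=1}^m h_i^2\equiv_{\mathcal{I}}1$. $U_{k,\mathcal{I}}(\boldsymbol{h})=\mathrm{span}\{h_{i_1}\cdots h_{i_k}+\mathcal{I}: i_1,\dots,i_k\in\{1,\dots,m\}\}\subset\mathbb{R}[\boldsymbol{x}]/\mathcal{I}$, and $d_k$ is its dimension. $\boldsymbol{h}^{\otimes k}$ is the $k$-fold Kronecker power of $\boldsymbol{h}$ (the vector of all $m^k$ products $h_{i_1}\cdots h_{i_k}$). For $A$ symmetric and $B\succ0$ of the same size, $\lambda_{\min}(A,B)$ is the smallest generalized eigenvalue of the pair, i.e. $\max\{\gamma\in\mathbb{R}: A-\gamma B\succeq0\}$ (convention: $+\infty$ for $0\times 0$ matrices, which occur only if $\mathcal{I}=\mathbb{R}[\boldsymbol{x}]$). The problem $\max\{\gamma: A-\gamma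 B\succeq 0\}$ is a spectral relaxation of minimizing $p$ over $V_{\mathbb{R}}(\mathcal{I})$ if $A$ is symmetric, $B\succ0$, and $\lambda_{\min}(A,B)\le p(\boldsymbol{x})$ for all $\boldsymbol{x}\in V_{\mathbb{R}}(\mathcal{I})$. Initialization. Fix $\kappa$ and a basis $\boldsymbol{z}_\kappa+\mathcal{I}$ of $U_{\kappa,\mathcal{I}}(\boldsymbol{h})$, and let $\boldsymbol{P}\in\mathbb{R}^{m^\kappa\times d_\kappa}$ be the unique matrix with $\boldsymbol{P}\boldsymbol{z}_\kappa\equiv_{\mathcal{I}}\boldsymbol{h}^{\otimes\kappa}$. For $q\in\mathbb{R}[\boldsymbol{x}]$ with $q+\mathcal{I}\in U_{2\kappa,\mathcal{I}}(\boldsymbol{h})$, let $\boldsymbol{Y}(q)$ be the unique matrix of minimal Frobenius norm among all $\boldsymbol{Y}\in\mathbb{S}^{m^\kappa}$ with $q\equiv_{\mathcal{I}}(\boldsymbol{h}^{\otimes\kappa})^T\boldsymbol{Y}\boldsymbol{h}^{\otimes\kappa}$. Method 1: $\boldsymbol{M}_\kappa(q)=\boldsymbol{P}^T\boldsymbol{Y}(q)\boldsymbol{P}$. Method 2: $\boldsymbol{M}_\kappa(q)=\boldsymbol{P}^T\boldsymbol{Y}(q-q_0)\boldsymbol{P}+q_0\boldsymbol{P}^T\boldsymbol{P}$, where $q_0$ is the constant term of $q$. The same method is used for $q=1$ and $q=p$; one requires $\boldsymbol{M}_\kappa(1)\succ0$ (with Method 2 this is automatic). Iterative Construction. Start with $k=\kappa$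 and the matrices $\boldsymbol{M}_\kappa(1)\succ0$, $\boldsymbol{M}_\kappa(p)$ above. Given level $k$ with basis $\boldsymbol{z}_k+\mathcal{I}$ of $U_{k,\mathcal{I}}(\boldsymbol{h})$, fix a basis $\boldsymbol{z}_{k+1}+\mathcal{I}$ of $U_{k+1,\mathcal{I}}(\boldsymbol{h})$, let $\boldsymbol{L}_{k+1}\in\mathbb{R}^{md_k\times d_{k+1}}$ be the unique matrix with $\boldsymbol{L}_{k+1}\boldsymbol{z}_{k+1}\equiv_{\mathcal{I}}\boldsymbol{h}\otimes\boldsymbol{z}_k$, and set $\boldsymbol{M}_{k+1}(1)=\boldsymbol{L}_{k+1}^T(\boldsymbol{I}_m\otimes\boldsymbol{M}_k(1))\boldsymbol{L}_{k+1}$ and $\boldsymbol{M}_{k+1}(p)=\boldsymbol{L}_{k+1}^T(\boldsymbol{I}_m\otimes\boldsymbol{M}_k(p))\boldsymbol{L}_{k+1}$, where $\boldsymbol{I}_m$ is the $m\times m$ identity; repeat with $k+1$. *)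

(* Defs.v *)
(* [mpoly] has to be imported before the
   analysis files: the opposite order makes their notation levels clash. *)
From HB Require Import structures.
From mathcomp Require Import all_boot all_order all_algebra.
From mathcomp Require Import mpoly mxtens.
From mathcomp Require Import classical_sets reals constructive_ereal ereal.

Set Implicit Arguments.
Unset Strict Implicit.
Unset Printing Implicit Defensive.

Import Order.TTheory GRing.Theory Num.Theory.

Local Open Scope classical_set_scope.
Local Open Scope ring_scope.

Section SymmetricMatrices.
Context {R : realType}.

Definition qform {d : nat} (A : 'M[R]_d) (v : 'cV[R]_d) : R :=
  (v^T *m A *m v) 0 0.

Definition possemidef {d : nat} (A : 'M[R]_d) : Prop :=
  A \is symmetricmx /\ forall v : 'cV[R]_d, 0 <= qform A v.

Definition posdef {d : nat} (A : 'M[R]_d) : Prop :=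
  A \is symmetricmx /\ forall v : 'cV[R]_d, v != 0 -> 0 < qform A v.

Definition frobenius_norm {d e : nat} (A : 'M[R]_(d, e)) : R :=
  Num.sqrt (\sum_i \sum_j A i j ^+ 2).

Definition generalized_eigenvalue {d : nat} (A B : 'M[R]_d) (g : R) : Prop :=
  exists2 v : 'cV[R]_d, v != 0 & A *m v = g *: (B *m v).

(* The smallest generalized eigenvalue of the pair; as [ereal_inf set0 = +oo],
   this includes the convention for 0 x 0 matrices. *)
Definition lambda_min {d : nat} (A B : 'M[R]_d) : \bar R :=
  ereal_inf [set g%:E | g in [set g | generalized_eigenvalue A B g]].

Definition pencil_feasible {d : nat} (A B : 'M[R]_d) : set R :=
  [set g | possemidef (A - g *: B)].

Definition is_max (S : set R) (g : R) : Prop :=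
  S g /\ forall g', S g' -> g' <= g.

End SymmetricMatrices.

Section SphericalRelaxation.
Context {R : realType} {n : nat}.
Local Notation poly := {mpoly R[n]}.

Definition is_ideal (I : set poly) : Prop :=
  [/\ I 0, (forall f g, I f -> I g -> I (f + g))
    & (forall f g, I g -> I (f * g))].

Definition eqmod (I : set poly) (f g : poly) : Prop := I (f - g).

Definition eqmodmx (I : set poly) {d e : nat} (F G : 'M[poly]_(d, e)) : Prop :=
  forall i j, eqmod I (F i j) (G i j).

Definition real_variety (I : set poly) : set ('I_n -> R) :=
  [set x | forall g, I g -> g.@[x] = 0].

Definition polymx {d e : nat} (A : 'M[R]_(d, e)) : 'M[poly]_(d, e) :=
  map_mx (@mpolyC n R) A.

Definition spherical (I : set poly) {m : nat} (h : 'cV[poly]_m) : Prop :=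
  eqmod I (\sum_i h i 0 ^+ 2) 1.

(* [Uspan I h k f] states that the class f + I lies in U_{k,I}(h). *)
Definition Uspan (I : set poly) {m : nat} (h : 'cV[poly]_m) (k : nat)
    (f : poly) : Prop :=
  exists c : {ffun 'I_k -> 'I_m} -> R,
    eqmod I f (\sum_(s : {ffun 'I_k -> 'I_m}) c s *: \prod_(j < k) h (s j) 0).

(* The classes of the entries of z form a basis of U_{k,I}(h); thus d is the
   dimension of that space. *)
Definition is_basis (I : set poly) {m : nat} (h : 'cV[poly]_m) (k : nat)
    {d : nat} (z : 'cV[poly]_d) : Prop :=
  [/\ (forall i, Uspan I h k (z i 0)),
      (forall c : 'I_d -> R,
         eqmod I (\sum_i c i *: z i 0) 0 -> forall i, c i = 0)
    & (forall f, Uspan I h k f ->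
         exists c : 'I_d -> R, eqmod I f (\sum_i c i *: z i 0))].

(* The cast only turns the number of columns 1 ^ k into 1. *)
Definition kron_pow {m : nat} (h : 'cV[poly]_m) (k : nat) : 'cV[poly]_(m ^ k) :=
  castmx (erefl, exp1n k) (h ^t k).

Definition gram_of (I : set poly) {m : nat} (h : 'cV[poly]_m) (k : nat)
    (q : poly) (Y : 'M[R]_(m ^ k)) : Prop :=
  Y \is symmetricmx /\
  eqmod I q (((kron_pow h k)^T *m polymx Y *m kron_pow h k) 0 0).
Arguments gram_of I {m} h k q Y.

Definition min_gram_of (I : set poly) {m : nat} (h : 'cV[poly]_m) (k : nat)
    (q : poly) (Y : 'M[R]_(m ^ k)) : Prop :=
  gram_of I h k q Y /\
  forall Y', gram_of I h k q Y' -> frobenius_norm Y <= frobenius_norm Y'.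
Arguments min_gram_of I {m} h k q Y.

Variant init_method := Method1 | Method2.

(* q@_0%MM is the constant term of q. *)
Definition init_matrix (mt : init_method) (I : set poly) {m : nat}
    (h : 'cV[poly]_m) (k : nat) {d : nat} (P : 'M[R]_(m ^ k, d)) (q : poly)
    (M : 'M[R]_d) : Prop :=
  match mt with
  | Method1 =>
      exists2 Y, min_gram_of I h k q Y & M = P^T *m Y *m P
  | Method2 =>
      exists2 Y, min_gram_of I h k (q - (q@_0%MM)%:MP) Y
        & M = P^T *m Y *m P + q@_0%MM *: (P^T *m P)
  end.
Arguments init_matrix mt I {m} h k {d} P q M.

Definition initialization (mt : init_method) (I : set poly) {m : nat}
    (h : 'cV[poly]_m) (p : poly) (k : nat) {d : nat} (z : 'cV[poly]_d)
    (M1 Mp : 'M[R]_d) : Prop :=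
  exists P : 'M[R]_(m ^ k, d),
    [/\ eqmodmx I (polymx P *m z) (kron_pow h k),
        init_matrix mt I h k P 1 M1 & init_matrix mt I h k P p Mp].

(* The Kronecker product of two columns has type 'M_(_, 1 * 1), which is
   convertible to 'cV_(_). *)
Definition iteration_step (I : set poly) {m : nat} (h : 'cV[poly]_m)
    {d d' : nat} (z : 'cV[poly]_d) (M1 Mp : 'M[R]_d)
    (z' : 'cV[poly]_d') (M1' Mp' : 'M[R]_d') : Prop :=
  exists L : 'M[R]_(m * d, d'),
    [/\ eqmodmx I (polymx L *m z') (h *t z : 'cV[poly]_(m * d)),
        M1' = L^T *m (1%:M *t M1 : 'M[R]_(m * d)) *m L
      & Mp' = L^T *m (1%:M *t Mp : 'M[R]_(m * d)) *m L].

(* Only the levels k >= kappa of the families d, z, M1, Mp matter. *)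
Definition iterative_construction (mt : init_method) (I : set poly) {m : nat}
    (h : 'cV[poly]_m) (p : poly) (kappa : nat) (d : nat -> nat)
    (z : forall k, 'cV[poly]_(d k)) (M1 Mp : forall k, 'M[R]_(d k)) : Prop :=
  [/\ (forall k, (kappa <= k)%N -> is_basis I h k (z k)),
      initialization mt I h p kappa (z kappa) (M1 kappa) (Mp kappa),
      posdef (M1 kappa)
    & (forall k, (kappa <= k)%N ->
         iteration_step I h (z k) (M1 k) (Mp k) (z k.+1) (M1 k.+1) (Mp k.+1))].

Definition spectral_relaxation (I : set poly) (p : poly) {d : nat}
    (A B : 'M[R]_d) : Prop :=
  [/\ A \is symmetricmx, posdef B
    & forall x, real_variety I x -> (lambda_min A B <= (p.@[x])%:E)%E].

End SphericalRelaxation.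

(* Main.v *)
Require Import Defs.
From HB Require Import structures.
From mathcomp Require Import all_boot all_order all_algebra.
From mathcomp Require Import ring lra.
From mathcomp Require Import mpoly mxtens.
From mathcomp Require Import classical_sets reals constructive_ereal ereal.
Set Implicit Arguments.
Unset Strict Implicit.
Unset Printing Implicit Defensive.
Import Order.TTheory GRing.Theory Num.Theory.
Local Open Scope classical_set_scope.
Local Open Scope ring_scope.

(* For a positive definite pencil (A, B) the supremum g of the feasible set is
   attained, and A - g B is singular there, so g is the smallest generalized
   eigenvalue. At a point x of the variety both M_k(1) and M_k(p) are evaluated
   on the vector z_k(x), giving 1 and p(x); since the squares of h sum to 1 at
   x, this survives the passage to I (x) M_k followed by congruence with L.
   Hence p(x) is a Rayleigh quotient of the pencil. The sequence is
   non-decreasing because the same congruence preserves semidefiniteness, and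
   M_k(1) stays positive definite because L is injective. *)

(** * Quadratic forms of symmetric matrices *)

Section QuadraticForms.
Context {R : realType}.

Lemma symmetricmxP d (A : 'M[R]_d) : reflect (A^T = A) (A \is symmetricmx).
Proof.
apply: (iffP (is_hermitianmxP _ _ _)) => /=; rewrite expr0 scale1r => A_sym.
  by rewrite [RHS]A_sym; apply/matrixP => i j; rewrite !mxE.
by rewrite -[LHS]A_sym; apply/matrixP => i j; rewrite !mxE.
Qed.

Lemma qformE d (A : 'M[R]_d) v :
  qform A v = \sum_i \sum_j v i 0 * A i j * v j 0.
Proof.
rewrite /qform mxE exchange_big /=; apply: eq_bigr => j _.
by rewrite mxE mulr_suml; apply: eq_bigr => i _; rewrite mxE.
Qed.

Lemma qformBZ d (A B : 'M[R]_d) g v :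
  qform (A - g *: B) v = qform A v - g * qform B v.
Proof.
rewrite !qformE mulr_sumr -sumrB; apply: eq_bigr => i _.
rewrite mulr_sumr -sumrB; apply: eq_bigr => j _.
by rewrite !mxE; ring.
Qed.

Lemma qform_congr d e (A : 'M[R]_d) (L : 'M[R]_(d, e)) v :
  qform (L^T *m A *m L) v = qform A (L *m v).
Proof. by rewrite /qform trmx_mul !mulmxA. Qed.

Lemma qformZr d (A : 'M[R]_d) c v : qform A (c *: v) = c ^+ 2 * qform A v.
Proof.
rewrite !qformE mulr_sumr; apply: eq_bigr => i _; rewrite mulr_sumr.
by apply: eq_bigr => j _; rewrite !mxE; ring.
Qed.

Lemma symmetricmx_congr d e (A : 'M[R]_d) (L : 'M[R]_(d, e)) :
  A \is symmetricmx -> L^T *m A *m L \is symmetricmx.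
Proof.
move=> /symmetricmxP As; apply/symmetricmxP.
by rewrite !trmx_mul trmxK As mulmxA.
Qed.

Lemma symmetricmxBZ d (A B : 'M[R]_d) g :
  A \is symmetricmx -> B \is symmetricmx -> A - g *: B \is symmetricmx.
Proof.
move=> /symmetricmxP As /symmetricmxP Bs; apply/symmetricmxP.
by rewrite linearB /= linearZ /= As Bs.
Qed.

Lemma symmetricmx_tens1 m d (A : 'M[R]_d) :
  A \is symmetricmx -> (1%:M *t A : 'M[R]_(m * d)) \is symmetricmx.
Proof.
move=> /symmetricmxP As; apply/symmetricmxP.
by rewrite trmx_tens trmx1 As.
Qed.

(** * Kronecker products with the identity, and congruences *)

Definition tens_block m d (w : 'cV[R]_(m * d)) (i : 'I_m) : 'cV[R]_d :=
  \col_j w (mxtens_index (i, j)) 0.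

Lemma big_mxtens (V : nmodType) m d (F : 'I_(m * d) -> V) :
  \sum_i F i = \sum_i \sum_j F (mxtens_index (i, j)).
Proof.
rewrite pair_big /= (reindex (@mxtens_index m d)) /=.
  by apply: eq_bigr => -[].
by exists (@mxtens_unindex m d) => ? _; rewrite (mxtens_indexK, mxtens_unindexK).
Qed.

(** [1%:M *t A] is block diagonal with [m] copies of [A], so different blocks of [w] do not
    interact. *)
Lemma qform_tens1 m d (A : 'M[R]_d) (w : 'cV[R]_(m * d)) :
  qform (1%:M *t A : 'M[R]_(m * d)) w = \sum_i qform A (tens_block w i).
Proof.
rewrite qformE big_mxtens; apply: eq_bigr => i _; rewrite qformE.
apply: eq_bigr => j _; rewrite big_mxtens (bigD1 i) //=.
rewrite [X in _ + X]big1 ?addr0; last first.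
  move=> k ki; apply: big1 => l _.
  by rewrite tensmxE mxE eq_sym (negPf ki) mul0r mulr0 mul0r.
by apply: eq_bigr => l _; rewrite tensmxE !mxE eqxx mul1r.
Qed.

Lemma possemidef_tens1 m d (A : 'M[R]_d) :
  possemidef A -> possemidef (1%:M *t A : 'M[R]_(m * d)).
Proof.
move=> [As A0]; split; first exact: symmetricmx_tens1.
by move=> v; rewrite qform_tens1 sumr_ge0.
Qed.

Lemma posdef_possemidef d (A : 'M[R]_d) : posdef A -> possemidef A.
Proof.
move=> [As A0]; split=> // v; have [->|/A0/ltW//] := eqVneq v 0.
by rewrite /qform mulmx0 mxE.
Qed.

(** A vanishing sum of nonnegative block forms makes every block form vanish, hence every block of
    [w], hence [w]. *)
Lemma posdef_tens1 m d (A : 'M[R]_d) :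
  posdef A -> posdef (1%:M *t A : 'M[R]_(m * d)).
Proof.
move=> A0; split; first by apply: symmetricmx_tens1; case: A0.
move=> w w0; have [_ Age] := posdef_possemidef A0.
rewrite qform_tens1 lt0r sumr_ge0 // andbT; apply: contraNneq w0 => /eqP.
rewrite psumr_eq0 // => /allP w0; apply/eqP/matrixP => k j.
rewrite [j]ord1 mxE; case: (mxtens_indexP k) => a b.
have := w0 a (mem_index_enum _); rewrite /= => /eqP qa.
suff /matrixP/(_ b 0) : tens_block w a = 0 by rewrite !mxE.
by apply/eqP; apply: contraTT isT => /(proj2 A0); rewrite qa ltxx.
Qed.

Lemma possemidef_congr d e (A : 'M[R]_d) (L : 'M[R]_(d, e)) :
  possemidef A -> possemidef (L^T *m A *m L).
Proof.
move=> [As A0]; split; first exact: symmetricmx_congr.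
by move=> v; rewrite qform_congr.
Qed.

Lemma posdef_congr d e (A : 'M[R]_d) (L : 'M[R]_(d, e)) :
  (forall v : 'cV[R]_e, L *m v = 0 -> v = 0) ->
  posdef A -> posdef (L^T *m A *m L).
Proof.
move=> Linj [As A0]; split; first exact: symmetricmx_congr.
move=> v v0; rewrite qform_congr; apply: A0.
by apply: contra_neq v0; apply: Linj.
Qed.

(** * Comparison of a form with the squared Euclidean norm [qform 1%:M] *)

Lemma qform_le_normsq d (A : 'M[R]_d) :
  exists2 K : R, 0 < K & forall v, `|qform A v| <= K * qform 1%:M v.
Proof.
(* The summand [1] keeps the constant positive even for [A = 0]. *)
exists (1 + \sum_i \sum_j `|A i j|).
  by rewrite ltr_pwDl // sumr_ge0 // => i _; rewrite sumr_ge0.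
move=> v.
have n2E : qform 1%:M v = \sum_i v i 0 ^+ 2.
  by rewrite /qform mulmx1 mxE; apply: eq_bigr => i _; rewrite mxE expr2.
have coord i : v i 0 ^+ 2 <= qform 1%:M v.
  by rewrite n2E (bigD1 i) //= lerDl sumr_ge0 // => j _; rewrite sqr_ge0.
have n2_ge0 : 0 <= qform 1%:M v.
  by rewrite n2E sumr_ge0 // => i _; rewrite sqr_ge0.
have prod_le i j : `|v i 0| * `|v j 0| <= qform 1%:M v.
  have := coord i; have := coord j; rewrite -(real_normK (num_real (v i 0))).
  rewrite -(real_normK (num_real (v j 0))).
  (* Twice the product is at most the sum of the two squares, and each square is at most the squared
     norm. *)
  by have := sqr_ge0 (`|v i 0| - `|v j 0|); nra.
rewrite mulrDl mul1r.
apply: (@le_trans _ _ ((\sum_i \sum_j `|A i j|) * qform 1%:M v)).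
  2: by rewrite lerDr.
rewrite qformE mulr_suml; apply: (le_trans (ler_norm_sum _ _ _)).
apply: ler_sum => i _; rewrite mulr_suml.
apply: (le_trans (ler_norm_sum _ _ _)); apply: ler_sum => j _.
by rewrite !normrM mulrAC mulrC ler_wpM2l.
Qed.

Lemma qformD d (A : 'M[R]_d) v w : A \is symmetricmx ->
  qform A (v + w) = qform A v + 2 * (w^T *m A *m v) 0 0 + qform A w.
Proof.
move=> /symmetricmxP As.
have E : (v^T *m A *m w) 0 0 = (w^T *m A *m v) 0 0.
  have -> : w^T *m A *m v = (v^T *m A *m w)^T.
    by rewrite !trmx_mul trmxK As mulmxA.
  by rewrite [RHS]mxE.
have addE (M N : 'M[R]_1) : (M + N) 0 0 = M 0 0 + N 0 0 by rewrite mxE.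
by rewrite /qform [(v + w)^T]linearD /= !mulmxDl !mulmxDr !addE E; ring.
Qed.

(** The polynomial [qform A (v + t *: w)] in [t] is nonnegative, which bounds its discriminant. *)
Lemma possemidef_CauchySchwarz d (A : 'M[R]_d) v w : possemidef A ->
  ((w^T *m A *m v) 0 0) ^+ 2 <= qform A v * qform A w.
Proof.
move=> [As A0]; set b := (_ *m v) 0 0.
have H t : 0 <= qform A v + 2 * t * b + t ^+ 2 * qform A w.
  have := A0 (v + t *: w).
  by rewrite qformD // qformZr linearZ /= -!scalemxAl mxE mulrA.
have [w0|w0] := eqVneq (qform A w) 0.
  rewrite w0 mulr0; have [->|b0] := eqVneq b 0; first by rewrite expr0n.
  (* The polynomial is now affine with slope [2 * b]; this [t] gives it the value [-1]. *)
  exfalso; have := H (- (qform A v + 1) / (2 * b)).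
  rewrite w0 mulr0 addr0.
  have -> : 2 * (- (qform A v + 1) / (2 * b)) * b = - (qform A v + 1) by field.
  by lra.
have wp : 0 < qform A w by rewrite lt0r w0 A0.
(* This [t] minimizes the polynomial. *)
have := H (- b / qform A w).
have -> : qform A v + 2 * (- b / qform A w) * b
   + (- b / qform A w) ^+ 2 * qform A w = qform A v - b ^+ 2 / qform A w by field.
by rewrite subr_ge0 ler_pdivrMr.
Qed.

(* Cauchy-Schwarz for the form of [A], applied to [v] and [A^-1 v]. *)
Lemma possemidef_unit_ge d (A : 'M[R]_d) : possemidef A -> A \in unitmx ->
  exists2 c : R, 0 < c & forall v, c * qform 1%:M v <= qform A v.
Proof.
move=> Apsd Au; have /symmetricmxP As := proj1 Apsd.
have [K K0 HK] := qform_le_normsq (invmx A).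
exists K^-1; first by rewrite invr_gt0.
move=> v; rewrite mulrC ler_pdivrMr //.
have := possemidef_CauchySchwarz v (invmx A *m v) Apsd.
have -> : ((invmx A *m v)^T *m A *m v) 0 0 = qform 1%:M v.
  by rewrite trmx_mul trmx_inv As mulmxKV // /qform mulmx1.
have -> : qform A (invmx A *m v) = qform (invmx A) v.
  by rewrite -qform_congr trmx_inv As mulVmx // mul1mx.
have := HK v; rewrite ler_norml => /andP[_ ub].
have n0 : 0 <= qform 1%:M v.
  by rewrite /qform mulmx1 mxE sumr_ge0 // => i _; rewrite mxE -expr2 sqr_ge0.
have A0 := proj2 Apsd v.
(* With [N = qform 1%:M v], the bounds so far give [N ^+ 2 <= qform A v * (K * N)]; a factor [N]
   cancels unless it is zero. *)
have [->|nz] := eqVneq (qform 1%:M v) 0; first by rewrite mulr_ge0 // ltW.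
have np : 0 < qform 1%:M v by rewrite lt0r nz.
by nra.
Qed.

Lemma singular_vector d (A : 'M[R]_d) : A \notin unitmx ->
  exists2 v : 'cV[R]_d, v != 0 & A *m v = 0.
Proof.
(* [kermx] is a left kernel, so a row killing [A^T] is found first and then transposed. *)
rewrite -unitmx_tr -row_free_unit -kermx_eq0 => /rowV0Pn[u /sub_kermxP uA u0].
exists u^T; first by rewrite trmx_eq0.
by apply: trmx_inj; rewrite trmx_mul trmxK uA trmx0.
Qed.

Lemma posdef_unit d (A : 'M[R]_d) : posdef A -> A \in unitmx.
Proof.
move=> [_ A0]; apply: contraT => /singular_vector[v /A0].
by rewrite /qform -mulmxA => qv Av; rewrite Av mulmx0 mxE ltxx in qv.
Qed.

(** * The largest feasible parameter of a pencil and the smallest generalized eigenvalue *)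

(** Feasibility of [g] means that [g] is at most every Rayleigh quotient [qform A v / qform B v], a
    condition that passes to the supremum. For [d = 0] every [g] is feasible and there is no
    maximum. *)
Lemma pencil_feasible_has_max d (A B : 'M[R]_d) : (0 < d)%N ->
  A \is symmetricmx -> posdef B -> exists g, is_max (pencil_feasible A B) g.
Proof.
move=> d0 As Bpd; have [Bs B0] := Bpd.
pose v0 : 'cV[R]_d := const_mx 1.
have v00 : v0 != 0.
  by apply/negP => /eqP/matrixP/(_ (Ordinal d0) 0)/eqP; rewrite !mxE oner_eq0.
have ub g v : v != 0 -> pencil_feasible A B g -> g <= qform A v / qform B v.
  by move=> /B0 qB [_ /(_ v)]; rewrite qformBZ subr_ge0 ler_pdivlMr.
have hub : has_ubound (pencil_feasible A B).
  by exists (qform A v0 / qform B v0) => g; apply: ub.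
have nonempty : pencil_feasible A B !=set0.
  have [K K0 HK] := qform_le_normsq A.
  have [c c0 Hc] :=
    possemidef_unit_ge (posdef_possemidef Bpd) (posdef_unit Bpd).
  (* Relative to the squared norm, the form of [A] is at least [-K] and that of [B] at least [c], so
     adding [K / c] times [B] compensates for [A]. *)
  exists (- (K / c)); split; first exact: symmetricmxBZ.
  move=> v; rewrite qformBZ mulNr opprK.
  have := HK v; rewrite ler_norml => /andP[lb _].
  have : K / c * (c * qform 1%:M v) <= K / c * qform B v.
    by rewrite ler_pM2l // divr_gt0.
  by rewrite mulrA divfK ?gt_eqF //; lra.
exists (sup (pencil_feasible A B)); split; last first.
  by move=> g Sg; apply: ub_le_sup.
split; first exact: symmetricmxBZ.
move=> v; rewrite qformBZ subr_ge0.
have [->|vn0] := eqVneq v 0; first by rewrite /qform !mulmx0 mxE mulr0.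
by rewrite -ler_pdivlMr ?B0 //; apply: ge_sup => // g; apply: ub.
Qed.

(* At the maximal [g] the semidefinite matrix [A - g B] is singular: otherwise
   it would dominate [eps B] for some [eps > 0]. *)
Lemma is_max_eigenvalue d (A B : 'M[R]_d) g :
  A \is symmetricmx -> B \is symmetricmx ->
  is_max (pencil_feasible A B) g -> generalized_eigenvalue A B g.
Proof.
move=> As Bs [Sg gmax].
have [|v v0 Cv] := @singular_vector _ (A - g *: B); last first.
  exists v => //; apply/eqP; rewrite -subr_eq0 -Cv.
  by rewrite mulmxBl scalemxAl.
apply/negP => /(possemidef_unit_ge Sg)[c c0 Hc].
have [K K0 HK] := qform_le_normsq B.
(* The increment [c / K] is such that [c / K * qform B v] stays below [c * qform 1%:M v], the margin
   by which [A - g *: B] is positive. *)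
have : pencil_feasible A B (g + c / K).
  split; first exact: symmetricmxBZ.
  move=> v; rewrite qformBZ; have := Hc v; rewrite qformBZ.
  have := HK v; rewrite ler_norml => /andP[_ ubB].
  have : c / K * qform B v <= c / K * (K * qform 1%:M v).
    by rewrite ler_pM2l // divr_gt0.
  by rewrite mulrA divfK ?gt_eqF //; lra.
by move=> /gmax; rewrite gerDl leNgt divr_gt0.
Qed.

(** The maximum is itself an eigenvalue, and any eigenvalue is the Rayleigh quotient of its
    eigenvector, hence no smaller. *)
Lemma lambda_min_is_max d (A B : 'M[R]_d) g :
  A \is symmetricmx -> posdef B ->
  is_max (pencil_feasible A B) g -> lambda_min A B = g%:E.
Proof.
move=> As [Bs B0] gmax; apply/le_anti/andP; split.
  apply: ereal_inf_lbound; exists g => //.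
  exact: is_max_eigenvalue.
apply: le_ereal_inf_tmp => _ [l [v v0 Av] <-].
have qA : qform A v = l * qform B v.
  by rewrite /qform -mulmxA Av -scalemxAr mxE mulmxA.
have Sg : possemidef (A - g *: B) := proj1 gmax.
rewrite lee_fin; have := proj2 Sg v.
by rewrite qformBZ subr_ge0 qA ler_pM2r // B0.
Qed.

(** Unlike the version with a maximum, this one covers [d = 0]: there are no eigenvalues, every [g]
    is feasible, and both sides are [+oo]. *)
Lemma lambda_min_sup d (A B : 'M[R]_d) : A \is symmetricmx -> posdef B ->
  lambda_min A B = ereal_sup [set g%:E | g in pencil_feasible A B].
Proof.
move=> As Bpd; have [d0|d0] := posnP d.
  have mx0 (e : nat) (M N : 'M[R]_(d, e)) : M = N.
    by apply/matrixP => i; have := ltn_ord i; rewrite {2}d0.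
  rewrite /lambda_min (_ : [set g | _] = set0); last first.
    by apply/seteqP; split=> // g [v /eqP]; case; apply: mx0.
  rewrite image_set0 ereal_inf0; apply/esym/eq_infty => r.
  apply: ereal_sup_ubound; exists r => //; split.
    by apply/symmetricmxP; apply: mx0.
  by move=> v; rewrite (mx0 _ v 0) /qform mulmx0 mxE.
have [g gmax] := pencil_feasible_has_max d0 As Bpd.
rewrite (lambda_min_is_max As Bpd gmax); apply/le_anti/andP; split.
  by apply: ereal_sup_ubound; exists g => //; case: gmax.
by apply: ge_ereal_sup => _ [l Sl <-]; rewrite lee_fin (proj2 gmax).
Qed.

(** The iteration step is linear in the matrix, so it carries [A - g *: B] to the new pencil at the
    same [g], and it preserves semidefiniteness. This yields monotonicity of the bounds. *)
Lemma pencil_feasible_step m d e (A B : 'M[R]_d) (L : 'M[R]_(m * d, e)) :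
  (pencil_feasible A B `<=`
   pencil_feasible (L^T *m (1%:M *t A : 'M[R]_(m * d)) *m L)
                   (L^T *m (1%:M *t B : 'M[R]_(m * d)) *m L))%classic.
Proof.
move=> g /(@possemidef_tens1 m)/(possemidef_congr L).
congr possemidef; rewrite scalemxAl scalemxAr -mulmxBl -mulmxBr.
congr (_ *m _ *m _); apply/matrixP => i j.
by rewrite !mxE; ring.
Qed.

End QuadraticForms.

Lemma sum_delta_scale (R : pzRingType) (V : lmodType R) (J : finType) a
    (F : J -> V) :
  \sum_j (j == a)%:R *: F j = F a.
Proof.
rewrite (bigD1 a) //= eqxx scale1r big1 ?addr0 // => j /negPf ->.
by rewrite scale0r.
Qed.

Section SphericalRelaxationTheory.
Context {R : realType} {n : nat}.
Local Notation poly := {mpoly R[n]}.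

(** * Congruence modulo the ideal and injectivity of the step matrix *)

Section Congruence.
Variables (I : set poly) (I_ideal : is_ideal I).

Lemma ideal_scale (c : R) f : I f -> I (c *: f).
Proof. by case: I_ideal => _ _ IM If; rewrite -mul_mpolyC; apply: IM. Qed.

Lemma eqmod_refl f : eqmod I f f.
Proof. by case: I_ideal => I0 _ _; rewrite /eqmod subrr. Qed.

Lemma eqmod_sym f g : eqmod I f g -> eqmod I g f.
Proof. by move=> /(ideal_scale (-1)); rewrite scaleN1r opprB. Qed.

Lemma eqmodD f g f' g' :
  eqmod I f g -> eqmod I f' g' -> eqmod I (f + f') (g + g').
Proof.
by case: I_ideal => _ ID _ fg fg'; rewrite /eqmod opprD addrACA; apply: ID.
Qed.

Lemma eqmod_trans g f f' : eqmod I f g -> eqmod I g f' -> eqmod I f f'.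
Proof.
case: I_ideal => _ ID _ fg gf'; rewrite /eqmod.
by rewrite -[f](subrK g) -addrA; apply: ID.
Qed.

Lemma eqmodZ c f g : eqmod I f g -> eqmod I (c *: f) (c *: g).
Proof. by rewrite /eqmod -scalerBr; apply: ideal_scale. Qed.

Lemma eqmodMl a f g : eqmod I f g -> eqmod I (a * f) (a * g).
Proof. by case: I_ideal => _ _ IM; rewrite /eqmod -mulrBr; apply: IM. Qed.

Lemma eqmod_sum (J : finType) (F G : J -> poly) :
  (forall j, eqmod I (F j) (G j)) -> eqmod I (\sum_j F j) (\sum_j G j).
Proof.
move=> FG; elim/big_rec2: _ => [|j f g _ fg]; first exact: eqmod_refl.
exact: eqmodD.
Qed.

Definition combines_to d (w : 'I_d -> poly) (f : poly) : Prop :=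
  exists c : 'I_d -> R, eqmod I f (\sum_j c j *: w j).

Lemma combines_to_sum d (w : 'I_d -> poly) (J : finType) (c : J -> R) F :
  (forall j, combines_to w (F j)) -> combines_to w (\sum_j c j *: F j).
Proof.
move=> wF; elim/big_rec: _ => [|j f _ [b fb]].
  exists (fun=> 0); rewrite big1; first exact: eqmod_refl.
  by move=> i _; rewrite scale0r.
have [a Fa] := wF j; exists (fun i => c j * a i + b i).
apply: eqmod_trans (eqmodD (eqmodZ (c j) Fa) fb) _.
rewrite scaler_sumr -big_split; apply: eqmod_sum => i /=.
by rewrite scalerDl scalerA; apply: eqmod_refl.
Qed.

Lemma eqmod_meval x f g : real_variety I x -> eqmod I f g -> f.@[x] = g.@[x].
Proof. by move=> Vx /Vx; rewrite mevalB => /eqP; rewrite subr_eq0 => /eqP. Qed.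

(** Splitting the first factor off a product of [k.+1] entries of [h] leaves an element of level
    [k], which expands in the basis [z]. *)
Lemma tens_combines m d (h : 'cV[poly]_m) (z : 'cV[poly]_d) k f :
  is_basis I h k z -> Uspan I h k.+1 f ->
  combines_to (fun j => (h *t z : 'cV[poly]_(m * d)) j 0) f.
Proof.
move=> [_ _ zspan] [c fc].
suff [b fb] : combines_to (fun j => (h *t z : 'cV[poly]_(m * d)) j 0)
    (\sum_(s : {ffun 'I_k.+1 -> 'I_m}) c s *: \prod_(j < k.+1) h (s j) 0).
  by exists b; apply: eqmod_trans fb.
apply: combines_to_sum => s; rewrite big_ord_recl.
have [|a za] := zspan (\prod_(i < k) h (s (lift ord0 i)) 0).
  pose s' : {ffun 'I_k -> 'I_m} := [ffun i => s (lift ord0 i)].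
  exists (fun t => (t == s')%:R).
  rewrite sum_delta_scale (eq_bigr (fun j => h (s' j) 0)); first exact: eqmod_refl.
  by move=> i _; rewrite ffunE.
(* The coefficients [a] of the tail are placed in the block of the first factor, with zeros
   elsewhere. *)
exists (fun j => ((mxtens_unindex j).1 == s ord0)%:R * a (mxtens_unindex j).2).
apply: eqmod_trans (eqmodMl _ za) _.
rewrite big_mxtens -(sum_delta_scale (s ord0)
  (fun i => h i 0 * \sum_j a j *: z j 0)).
apply: eqmod_sum => i; rewrite mulr_sumr scaler_sumr.
apply: eqmod_sum => j; rewrite mxtens_indexK mxE mxtens_indexK !ord1.
by rewrite -scalerAr scalerA; apply: eqmod_refl.
Qed.

Lemma polymx_mulE d e (L : 'M[R]_(d, e)) (z : 'cV[poly]_e) i :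
  (polymx L *m z) i 0 = \sum_l L i l *: z l 0.
Proof. by rewrite mxE; apply: eq_bigr => l _; rewrite mxE mul_mpolyC. Qed.

(* Expressing [z'] through [h *t z], and that through [z'] by [L], gives a left
   inverse of [L], since the classes of [z'] are linearly independent. *)
Lemma step_matrix_inj m d d' (h : 'cV[poly]_m) k (z : 'cV[poly]_d)
    (z' : 'cV[poly]_d') (L : 'M[R]_(m * d, d')) :
  is_basis I h k z -> is_basis I h k.+1 z' ->
  eqmodmx I (polymx L *m z') (h *t z : 'cV[poly]_(m * d)) ->
  forall v : 'cV[R]_d', L *m v = 0 -> v = 0.
Proof.
move=> zb [z'span z'free _] Lz v Lv; apply/matrixP => i j; rewrite ord1 mxE {j}.
have [c z'c] := tens_combines zb (z'span i).
(* [c] is row [i] of the left inverse. *)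
have cL l : \sum_j c j * L j l = (l == i)%:R.
  apply/eqP; rewrite -subr_eq0; apply/eqP; move: l.
  apply: z'free.
  have -> : \sum_l (\sum_j c j * L j l - (l == i)%:R) *: z' l 0
      = \sum_j c j *: (polymx L *m z') j 0 - z' i 0.
    rewrite (eq_bigr (fun l => \sum_j c j *: (L j l *: z' l 0)
       - (l == i)%:R *: z' l 0)); last first.
      move=> l _; rewrite scalerBl scaler_suml; congr (_ - _).
      by apply: eq_bigr => j _; rewrite scalerA.
    rewrite sumrB; congr (_ - _).
      rewrite exchange_big /=; apply: eq_bigr => j _.
      by rewrite polymx_mulE scaler_sumr.
    exact: sum_delta_scale.
  rewrite /eqmod subr0; apply: eqmod_sym.
  apply: eqmod_trans z'c _; apply: eqmod_sum => j; apply: eqmodZ.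
  exact/eqmod_sym/Lz.
transitivity (\sum_l (l == i)%:R * v l 0).
  by rewrite -(sum_delta_scale (V := R^o) i (v^~ 0)).
rewrite (eq_bigr (fun l => \sum_j c j * (L j l * v l 0))); last first.
  move=> l _; rewrite -cL mulr_suml; apply: eq_bigr => j _.
  by rewrite mulrA.
rewrite exchange_big /= big1 // => j _.
have := congr1 (fun M : 'cV[R]_(m * d) => M j 0) Lv.
by rewrite -mulr_sumr !mxE => ->; rewrite mulr0.
Qed.

End Congruence.

(** * Evaluation at points of the real variety *)

Lemma map_polymx d e (A : 'M[R]_(d, e)) x :
  map_mx (meval x) (polymx A : 'M[poly]_(d, e)) = A.
Proof. by apply/matrixP => i j; rewrite !mxE mevalC. Qed.

(** Sums of squares multiply under Kronecker products, and [ntensmx_rec h k] has [k.+1] factors.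
    Keeping [j] arbitrary avoids a cast of the column count [1 ^ k.+1]. *)
Lemma sum_sqr_ntensmx_rec m (h : 'cV[poly]_m) k j :
  \sum_i (ntensmx_rec h k i j) ^+ 2 = (\sum_i h i 0 ^+ 2) ^+ k.+1.
Proof.
elim: k j => [|k IH] j /=.
  by rewrite expr1; apply: eq_bigr => i _; rewrite (ord1 j).
rewrite exprS -(IH (mxtens_unindex j).2) mulr_sum; apply: eq_bigr => i _.
by rewrite mxE exprMn (ord1 (mxtens_unindex j).1).
Qed.

Lemma sum_sqr_kron_pow m (h : 'cV[poly]_m) k :
  \sum_i (kron_pow h k i 0) ^+ 2 = (\sum_i h i 0 ^+ 2) ^+ k.
Proof.
case: k => [|k].
  by rewrite big_ord1 castmxE !mxE !ord1 eqxx expr1n expr0.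
by under eq_bigr do rewrite castmxE cast_ord_id; apply: sum_sqr_ntensmx_rec.
Qed.

(** The invariant of the iteration: a Gram identity for [q], kept only as values on the variety
    instead of modulo [I]. *)
Definition represents (I : set poly) d (z : 'cV[poly]_d) (q : poly)
    (M : 'M[R]_d) : Prop :=
  M \is symmetricmx /\ forall x, real_variety I x ->
    qform M (map_mx (meval x) z) = q.@[x].

Section Evaluation.
Variables (I : set poly) (m : nat) (h : 'cV[poly]_m).
Hypothesis h_spherical : spherical I h.

Lemma spherical_meval x : real_variety I x -> \sum_i (h i 0).@[x] ^+ 2 = 1.
Proof.
move=> Vx; have := eqmod_meval Vx h_spherical; rewrite meval1 raddf_sum /= => <-.
by apply: eq_bigr => i _; rewrite rmorphXn.
Qed.

Lemma gram_of_meval k q (Y : 'M[R]_(m ^ k)) x : gram_of I h q Y ->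
  real_variety I x -> qform Y (map_mx (meval x) (kron_pow h k)) = q.@[x].
Proof.
move=> [_ qY] Vx; rewrite (eqmod_meval Vx qY).
rewrite -[in LHS](map_polymx Y x) /qform map_trmx -!map_mxM.
by rewrite [LHS]mxE.
Qed.

Lemma kron_pow_normsq k x : real_variety I x ->
  qform 1%:M (map_mx (meval x) (kron_pow h k)) = 1.
Proof.
move=> Vx; rewrite /qform mulmx1 mxE.
transitivity ((\sum_i (kron_pow h k i 0) ^+ 2).@[x]).
  by rewrite raddf_sum; apply: eq_bigr => i _; rewrite /= rmorphXn expr2 !mxE.
rewrite sum_sqr_kron_pow rmorphXn /= -[RHS](expr1n _ k); congr (_ ^+ k).
by have := eqmod_meval Vx h_spherical; rewrite meval1.
Qed.

Lemma eqmodmx_meval d e (P : 'M[R]_(d, e)) (z : 'cV[poly]_e) (w : 'cV[poly]_d) x :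
  real_variety I x -> eqmodmx I (polymx P *m z) w ->
  P *m map_mx (meval x) z = map_mx (meval x) w.
Proof.
move=> Vx Pz; rewrite -[P in LHS](map_polymx P x) -map_mxM.
by apply/matrixP => i j; rewrite ![map_mx _ _ i j]mxE; apply: eqmod_meval (Pz i j).
Qed.

Lemma init_matrix_represents mt k d (z : 'cV[poly]_d) (P : 'M[R]_(m ^ k, d)) q M :
  eqmodmx I (polymx P *m z) (kron_pow h k) ->
  init_matrix mt I h P q M -> represents I z q M.
Proof.
move=> Pz; case: mt => -[Y [gY _] ->].
  split=> [|x Vx]; first by apply: symmetricmx_congr; case: gY.
  by rewrite qform_congr (eqmodmx_meval Vx Pz) (gram_of_meval gY Vx).
set c := q@_0%MM.
(* Method 2 is the congruence by [P] of [Y] plus [c] times the identity; as [kron_pow h k] is a unit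
   vector on the variety, this adds back the constant [c]. *)
have -> : P^T *m Y *m P + c *: (P^T *m P) = P^T *m (Y - (- c) *: 1%:M) *m P.
  by rewrite scaleNr opprK mulmxDr mulmxDl -scalemxAr mulmx1 scalemxAl.
split=> [|x Vx].
  apply: symmetricmx_congr; apply: symmetricmxBZ; first by case: gY.
  by apply/symmetricmxP; rewrite trmx1.
rewrite qform_congr (eqmodmx_meval Vx Pz) qformBZ (gram_of_meval gY Vx).
by rewrite kron_pow_normsq // mevalB mevalC mulr1 opprK subrK.
Qed.

Lemma step_represents d d' (z : 'cV[poly]_d) (z' : 'cV[poly]_d')
    (L : 'M[R]_(m * d, d')) q M :
  eqmodmx I (polymx L *m z') (h *t z : 'cV[poly]_(m * d)) ->
  represents I z q M ->
  represents I z' q (L^T *m (1%:M *t M : 'M[R]_(m * d)) *m L).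
Proof.
move=> Lz [Ms Mq]; split; first by apply/symmetricmx_congr/symmetricmx_tens1.
move=> x Vx; rewrite qform_congr (eqmodmx_meval Vx Lz) qform_tens1.
(* The value [q.@[x]] is split with weights [(h i 0).@[x] ^+ 2], since block [i] of [h *t z] at [x]
   is [z] at [x] scaled by [(h i 0).@[x]]. *)
rewrite -[RHS]mul1r -(spherical_meval Vx) mulr_suml; apply: eq_bigr => i _.
rewrite -Mq // -qformZr; congr qform; apply/matrixP => j l.
by rewrite !mxE mxtens_indexK rmorphM /= !ord1.
Qed.

End Evaluation.

(** * Bounds along the construction and their monotonicity *)

Lemma represents_spectral_relaxation (I : set poly) d (z : 'cV[poly]_d) p A B :
  represents I z p A -> represents I z 1 B -> posdef B ->
  spectral_relaxation I p A B.
Proof.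
move=> [As Ap] [_ B1] Bpd; split=> // x Vx.
rewrite lambda_min_sup //; apply: ge_ereal_sup => _ [g [_ Sg] <-].
(* At [z] evaluated in [x], semidefiniteness of the pencil reads [0 <= p.@[x] - g]. *)
have := Sg (map_mx (meval x) z).
by rewrite qformBZ Ap // B1 // meval1 mulr1 subr_ge0 lee_fin.
Qed.

Lemma iterative_construction_represents (I : set poly) m (h : 'cV[poly]_m) p
    kappa mt d (z : forall k, 'cV[poly]_(d k)) (M1 Mp : forall k, 'M[R]_(d k)) k :
  is_ideal I -> spherical I h ->
  iterative_construction mt I h p kappa z M1 Mp -> (kappa <= k)%N ->
  [/\ represents I (z k) p (Mp k), represents I (z k) 1 (M1 k)
    & posdef (M1 k)].
Proof.
move=> I_ideal sph [bas [P [Pz i1 ip]] pd step].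
elim: k => [|k IH]; rewrite leq_eqVlt => /predU1P[<-|lek] //.
(* The starting level [kappa] is met either as [0] or as a successor; both cases rest on the
   initialization. *)
- by split=> //; apply: (init_matrix_represents sph Pz); [exact: ip|exact: i1].
- by split=> //; apply: (init_matrix_represents sph Pz); [exact: ip|exact: i1].
have [rp r1 pk] := IH lek; have [L [Lz -> ->]] := step k lek.
split; [exact: (step_represents sph Lz rp)|exact: (step_represents sph Lz r1)|].
apply: posdef_congr; last exact: posdef_tens1.
exact: (step_matrix_inj I_ideal (bas k lek) (bas _ (leqW lek)) Lz).
Qed.

End SphericalRelaxationTheory.

Theorem theorem3p1 (R : realType) (n m : nat) (p : {mpoly R[n]})
  (I : set {mpoly R[n]}) (I_ideal : is_ideal I)
  (h : 'cV[{mpoly R[n]}]_m) (h_spherical : spherical I h)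
  (kappa : nat) (kappa_in : Uspan I h (2 * kappa) p)
  (kappa_min : forall k : nat, Uspan I h (2 * k) p -> (kappa <= k)%N)
  (mt : init_method) (d : nat -> nat)
  (z : forall k : nat, 'cV[{mpoly R[n]}]_(d k))
  (M1 Mp : forall k : nat, 'M[R]_(d k))
  (constr : iterative_construction mt I h p kappa z M1 Mp) :
  [/\ (forall k : nat, (kappa <= k)%N ->
         [/\ spectral_relaxation I p (Mp k) (M1 k),
             lambda_min (Mp k) (M1 k) =
               ereal_sup [set g%:E | g in pencil_feasible (Mp k) (M1 k)]
           & (0 < d k)%N ->
             exists2 g : R, lambda_min (Mp k) (M1 k) = g%:E
               & is_max (pencil_feasible (Mp k) (M1 k)) g]),
      (forall j k : nat, (kappa <= j)%N -> (j <= k)%N ->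
         (lambda_min (Mp j) (M1 j) <= lambda_min (Mp k) (M1 k))%E)
    & (forall k : nat, (kappa <= k)%N ->
         (lambda_min (Mp k) (M1 k) <=
            ereal_inf [set (p.@[x])%:E | x in real_variety I])%E)].
Proof.
have level k :=
  iterative_construction_represents I_ideal h_spherical constr (k := k).
have relax k : (kappa <= k)%N -> spectral_relaxation I p (Mp k) (M1 k).
  by move=> /level[]; apply: represents_spectral_relaxation.
split.
- move=> k le_k; have [As Bpd _] := relax k le_k.
  split=> [||d0]; [exact: relax | exact: lambda_min_sup |].
  have [g gmax] := pencil_feasible_has_max d0 As Bpd.
  by exists g => //; apply: lambda_min_is_max gmax.
- move=> j k le_j; elim: k => [|k IH]; first by rewrite leqn0 => /eqP <-.
  rewrite leq_eqVlt => /predU1P[<- //|le_jk]; apply: le_trans (IH le_jk) _.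
  have le_k := leq_trans le_j le_jk.
  have [As Bpd _] := relax k le_k; have [As' Bpd' _] := relax k.+1 (leqW le_k).
  (* Feasible sets grow with the level, hence so do their suprema, including the value [+oo]. *)
  rewrite !lambda_min_sup //; apply: ereal_sup_le.
  case: constr => _ _ _ /(_ k le_k)[L [_ -> ->]].
  by apply: image_subset; apply: pencil_feasible_step.
- move=> k le_k; apply: le_ereal_inf_tmp => _ [x Vx <-].
  by have [_ _] := relax k le_k; apply.
Qed.
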